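(* Let $B^{b,+}_\infty$ be the space of real functions $f$ of $z>0$ of the form $f=\int_0^V[x_u]\,du$, i.e. $f(z)=\int_0^V[x_u](z)\,du$, where $V<\infty$ and $u\mapsto x_u\in[-1,1]$ is a measurable function of $u\in[0,V]$ such that $x_u\smile x_v=x_u$ for $u\le v$. Then $B^{b,+}_\infty$, endowed with the pointwise operations of functions and the map $$f=\int_0^V[x_u]\,du\ \longmapsto\ \|f\|_0=\sup\{u\in\mathbb R_{\ge0}\mid x_u\neq0\},$$ is a real Banach algebra.
   Context: For $x\in[-1,1]$, $[x]$ denotes the function of $z>0$ given by $[x](z)=\mathrm{sign}(x)|x|^z$ (and $[0]=0$). The condition $x_u\smile x_v=x_u$ refers to the hyperaddition of the real tropical hyperfield; for $a,b\in\mathbb R$, $a\smile b=a$ means: $|a|\ge|b|$, and $a=b$ whenever $|a|=|b|$. By convention $\sup\emptyset=0$, and in the definition of $\|f\|_0$ only $u$ in the domain $[0,V]$ are considered. *)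

(* Defs.v *)
From HB Require Import structures.
From mathcomp Require Import all_boot all_order all_algebra.
From mathcomp Require Import all_classical all_reals all_analysis.
Set Implicit Arguments.
Unset Strict Implicit.
Unset Printing Implicit Defensive.
Import Order.TTheory GRing.Theory Num.Theory.
Import numFieldNormedType.Exports.
Local Open Scope classical_set_scope.
Local Open Scope ring_scope.

(** The function [x](z) = sign(x) |x|^z of z > 0.  The library's [powR] has
    [0 `^ z = 0] for [z != 0], and anyway [Num.sg 0 = 0], so [0] = 0. *)
Definition teich (R : realType) (x : R) (z : {posnum R}) : R :=
  Num.sg x * (`|x| `^ z%:num).

(** [smile_absorbs a b] is a ⌣ b = a, for the (multivalued) hyperaddition ⌣ of
    the real tropical hyperfield. *)
Definition smile_absorbs (R : realType) (a b : R) : Prop :=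
  `|b| <= `|a| /\ (`|a| = `|b| -> a = b).

(** Only the values of [x] on [0, V] are constrained (and used below).
    Measurability is with respect to the Borel sigma-algebra. *)
Definition tropical_family (R : realType) (V : R) (x : R -> R) : Prop :=
  [/\ 0 <= V,
      measurable_fun `[0, V] x,
      (forall u, u \in `[0, V] -> x u \in `[-1, 1]) &
      forall u v, u \in `[0, V] -> v \in `[0, V] -> u <= v ->
        smile_absorbs (x u) (x v)].

Definition tropical_integral (R : realType) (V : R) (x : R -> R) :
    {posnum R} -> R :=
  fun z => \int[lebesgue_measure]_(u in `[0, V]) teich (x u) z.

Definition Bbp_infty (R : realType) : set ({posnum R} -> R) :=
  [set f | exists V x, tropical_family V x /\ f = tropical_integral V x].
Arguments Bbp_infty R : clear implicits.

(** [sup set0 = 0] in the library. *)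
Definition support_sup (R : realType) (V : R) (x : R -> R) : R :=
  sup [set u : R | u \in `[0, V] /\ x u != 0].

(** A set [B] of real functions on [T], with the pointwise operations and the
    map [N] restricted to [B] as norm, is a (unital) real Banach algebra.  That
    [B] is a linear subspace on which [N] is a complete norm is expressed by
    identifying [B] linearly and isometrically with a complete normed module. *)
Definition banach_function_algebra (R : realType) (T : Type)
    (B : set (T -> R)) (N : (T -> R) -> R) : Prop :=
  [/\ exists (E : completeNormedModType R) (j : {linear E -> (T -> R)}),
        [/\ injective j, range j = B & forall e : E, N (j e) = `|e|],
      (forall f g : T -> R, B f -> B g -> B (f * g) /\ N (f * g) <= N f * N g) &
      B (cst 1) /\ N (cst 1) = 1].

(* Main.v *)
Require Import Defs.
From HB Require Import structures.
From mathcomp Require Import all_boot all_order all_algebra.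
From mathcomp Require Import all_classical all_reals all_analysis.
From mathcomp Require Import measurable_realfun ring lra.
Import Order.TTheory GRing.Theory Num.Theory.
Import numFieldNormedType.Exports.
Local Open Scope classical_set_scope.
Local Open Scope ring_scope.

Set Implicit Arguments.
Unset Strict Implicit.
Unset Printing Implicit Defensive.

(** Pushing the Lebesgue measure of [0, V] forward along u |-> x_u turns the
    integral f(z) of [x_u](z) into the integral of [t](z) against a finite
    positive measure nu on [-1, 1]; conversely any such nu is allowed here as a
    description of f.  Folding the sign of t into a sign of the measure, f is
    the Laplace transform of a finite signed measure on [0, +oo[ (with
    |t| = exp(-xi)), and the claim is that the tropical condition picks the
    description of least mass, so that the norm is the total variation norm.
    The proof works with positive measures on [-1, 1] only, and defines the
    norm of f as the infimum of the masses nu(R) over all nu describing f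
    ([tropical_norm]).  Four facts carry the argument.

    - The descriptions are stable under the operations.  Measures are added
      for sums and for absolutely convergent series, and, since
      [s](z) [t](z) = [st](z), the product of two transforms is described by
      the image of the product measure under multiplication ([has_massD],
      [has_massM], [has_mass_series]).  This gives the triangle inequality,
      submultiplicativity and completeness.  Moreover |f(z)| <= nu(R), so
      that only f = 0 has norm 0.

    - Two descriptions eta and nu of the same f integrate every odd bounded
      Borel function to the same value ([Rintegral_odd_laplace]): with m' the
      reflection of m at 0, the measures eta + nu' and nu + eta' have the same
      even moments trivially and the same odd moments because [t](k) = t^k for
      odd k, and the moments of a finite measure on [-1, 1] determine it
      ([eq_moments_image_clamp]).

    - For a tropical family, the sign of x_u is a Borel function of |x_u|.
      Hence there is an odd Borel function phi, bounded by 1, with phi(x_u) = 1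
      when x_u > 0 or x_u < 0.  Integrating phi against the image of the
      Lebesgue measure gives the length of the support, and against any other
      nu describing f at most nu(R).  So the support length is the least mass
      ([support_sup_le_mass]).

    - Every transform is a tropical integral ([has_mass_tropical]).  Folding
      nu at 0 gives a difference of two measures on [0, 1]; its Jordan
      decomposition is a measure m with a sign that depends on the point
      only, and the quantile function of m rearranges m into a nonincreasing
      function on [0, m(R)].

    Finally, a linear subspace with a norm for which absolutely convergent
    series converge is a complete normed module ([complete_normed_subspace]). *)

(** * Integrals of bounded functions against finite measures *)

Section finite_measure_integrals.
Context d (T : measurableType d) (R : realType).
Implicit Types (m : {measure set T -> \bar R}) (f g : T -> R).

Lemma integrable_bounded m f (M : R) : (m setT < +oo)%E ->
  measurable_fun setT f -> (forall x, `|f x| <= M) ->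
  m.-integrable setT (EFin \o f).
Proof.
move=> mfin mf fM; apply: measurable_bounded_integrable => //.
by exists M; split; [exact: num_real|move=> y My x _; exact: le_trans (fM x) (ltW My)].
Qed.

Lemma Rintegral_norm_le m f (M : R) : (m setT < +oo)%E ->
  measurable_fun setT f -> (forall x, `|f x| <= M) ->
  `|\int[m]_x f x| <= M * fine (m setT).
Proof.
move=> mfin mf fM; have M0 : 0 <= M := le_trans (normr_ge0 _) (fM point).
have intf := integrable_bounded mfin mf fM.
apply: (le_trans (le_normr_Rintegral measurableT intf)).
rewrite -(Rintegral_cst m measurableT); apply: le_Rintegral => //.
  apply: (@integrable_bounded _ _ M) => //; first exact: measurableT_comp.
  by move=> x; rewrite normr_id.
by apply: (@integrable_bounded _ _ M) => // x; rewrite ger0_norm.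
Qed.

Lemma Rintegral_measure_add m1 m2 f (M : R) :
  (m1 setT < +oo)%E -> (m2 setT < +oo)%E ->
  measurable_fun setT f -> (forall x, `|f x| <= M) ->
  \int[measure_add m1 m2]_x f x = \int[m1]_x f x + \int[m2]_x f x.
Proof.
move=> m1fin m2fin mf fM.
have i1 := integrable_bounded m1fin mf fM; have i2 := integrable_bounded m2fin mf fM.
by rewrite /Rintegral integral_measure_add// fineD//; exact: integrable_fin_num.
Qed.

End finite_measure_integrals.

Lemma Rintegral_mrestr d (T : measurableType d) (R : realType)
    (m : {measure set T -> \bar R}) (D : set T) (mD : measurable D)
    (f : T -> R) (M : R) : (m D < +oo)%E ->
  measurable_fun setT f -> (forall x, `|f x| <= M) ->
  \int[mrestr m mD]_x f x = \int[m]_(x in D) f x.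
Proof.
move=> mfin mf fM; congr fine.
have m0 : mrestr m mD (~` D) = 0%E by rewrite /mrestr setICl measure0.
rewrite (@negligible_integral _ _ _ _ setT (~` D))//; last 2 first.
- exact: measurableC.
- by apply: (integrable_bounded (M := M)) => //=; rewrite /mrestr setTI.
rewrite setTD setCK; apply: eq_measure_integral => A mA AD.
by rewrite /= /mrestr setIidl.
Qed.

Section image_measure.
Context d d' (T1 : measurableType d) (T2 : measurableType d') (R : realType).

(** The measure structure of a pushforward depends on a proof that the map is
    measurable, which is kept here as an argument. *)
Definition image_measure (m : {measure set T1 -> \bar R}) (f : T1 -> T2)
  (mf : measurable_fun setT f) : {measure set T2 -> \bar R} :=
  measure_function_pushforward__canonical__measure_function_Measure m mf.

Lemma Rintegral_image_measure (m : {measure set T1 -> \bar R}) (f : T1 -> T2)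
  (mf : measurable_fun setT f) (g : T2 -> R) (M : R) : (m setT < +oo)%E ->
  measurable_fun setT g -> (forall x, `|g x| <= M) ->
  \int[image_measure m mf]_y g y = \int[m]_x g (f x).
Proof.
move=> mfin mg gM; rewrite /Rintegral /image_measure.
rewrite integral_pushforward//; first exact/measurable_EFinP.
rewrite preimage_setT; apply: (@integrable_bounded _ _ _ _ (g \o f) M) => //.
  exact: measurableT_comp.
by move=> x; exact: gM.
Qed.

End image_measure.

(** * The kernel of the transform *)

Section clamp.
Context (R : realType).
Implicit Types (t s : R) (z : {posnum R}).

(** Composing with the retraction of the line onto [-1, 1] lets all measures
    live on the whole line, with no condition on their support. *)
Definition clamp t : R := Num.max (-1) (Num.min 1 t).

Lemma normr_clamp t : `|clamp t| <= 1.
Proof.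
rewrite /clamp ler_norml le_max lexx/= ge_max ge_min lexx/=.
by rewrite andbT; lra.
Qed.

Lemma clamp_id t : `|t| <= 1 -> clamp t = t.
Proof. by rewrite /clamp ler_norml => /andP[t1 t2]; rewrite min_r// max_r. Qed.

Lemma clampN t : clamp (- t) = - clamp t.
Proof.
have [?|?] := ltP 1 t; have [?|?] := ltP t (-1); rewrite /clamp.
- lra.
- rewrite (@min_l _ _ 1 t) ?(@max_r _ _ (-1) 1) ?(@min_r _ _ 1 (-t)) ?max_l; lra.
- rewrite (@min_l _ _ 1 (-t)) ?(@max_r _ _ (-1) 1) ?(@min_r _ _ 1 t) ?max_l; lra.
- rewrite (@min_r _ _ 1 (-t)) ?(@min_r _ _ 1 t) ?max_r; lra.
Qed.

Lemma measurable_clamp : measurable_fun setT clamp.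
Proof.
rewrite (_ : clamp = cst (-1) \max (fun t => - (cst (-1) \max -%R) t)).
  apply: measurable_maxr; first exact: measurable_cst.
  apply: measurableT_comp => //; apply: measurable_maxr => //.
by apply/funext => t; rewrite /clamp /= oppr_max !opprK.
Qed.

Lemma measurable_sg : measurable_fun setT (@Num.sg R).
Proof.
rewrite (_ : @Num.sg R = fun t => \1_(`]0, +oo[%classic) t - \1_(`]-oo, 0[%classic) t).
  by apply: measurable_funB; apply: measurable_indic.
apply/funext => t; rewrite !indicE !mem_setE !in_itv/= andbT.
have [h|h|->] := ltgtP t 0; rewrite ?(ltr0_sg h) ?(gtr0_sg h) ?sgr0 ?mulr0n ?mulr1n.
- by rewrite sub0r.
- by rewrite subr0.
- by rewrite subr0.
Qed.

Lemma measurable_teich z : measurable_fun setT (@teich R ^~ z).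
Proof.
apply: measurable_funM; first exact: measurable_sg.
apply: (measurableT_comp (measurable_powR _)) => //.
Qed.

Lemma normr_sg_le1 t : `|Num.sg t| <= 1.
Proof. by rewrite normr_sg; case: (t == 0); rewrite ?ler01 ?lexx. Qed.

Lemma normr_teich_le1 t z : `|t| <= 1 -> `|teich t z| <= 1.
Proof.
move=> t1; rewrite /teich normrM mulr_ile1 ?normr_sg_le1//.
rewrite ger0_norm ?powR_ge0//.
by have := @ge0_ler_powR R z%:num (ltW _) `|t| 1; rewrite powR1 !nnegrE; apply.
Qed.

Lemma teichM s t z : teich (s * t) z = teich s z * teich t z.
Proof. by rewrite /teich sgrM normrM powRM//; ring. Qed.

Lemma teichN t z : teich (- t) z = - teich t z.
Proof. by rewrite /teich sgrN normrN mulNr. Qed.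

Lemma teich_sg t z : teich (Num.sg t) z = Num.sg t.
Proof.
rewrite /teich sgr_id normr_sg; have [->|t0] := eqVneq t 0; first by rewrite sgr0 mul0r.
by rewrite powR1 mulr1.
Qed.

End clamp.

(** * Transforms of finite measures form an algebra *)

Section laplace.
Context (R : realType).
Implicit Types (nu : {measure set R -> \bar R}) (z : {posnum R}).

Definition laplace nu : {posnum R} -> R := fun z => \int[nu]_t teich (clamp t) z.

Lemma measurable_teich_clamp z : measurable_fun setT (fun t : R => teich (clamp t) z).
Proof. exact: (measurableT_comp (measurable_teich z) (@measurable_clamp R)). Qed.

Lemma normr_teich_clamp_le1 z (t : R) : `|teich (clamp t) z| <= 1.
Proof. exact/normr_teich_le1/normr_clamp. Qed.

(** Different measures may have the same transform, with different masses: a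
    point mass at t and one at -t cancel each other.  The least mass will be the
    norm of the function. *)
Definition has_mass (f : {posnum R} -> R) (M : R) :=
  exists nu : {measure set R -> \bar R}, nu setT = M%:E /\ f = laplace nu.

(** It is enough to describe a function by a measure on any measurable space,
    since the image measure on the line has the same mass. *)
Lemma has_mass_image d (T : measurableType d) (m : {measure set T -> \bar R})
    (y : T -> R) (M : R) : m setT = M%:E ->
  measurable_fun setT y -> (forall x, `|y x| <= 1) ->
  has_mass (fun z => \int[m]_x teich (y x) z) M.
Proof.
move=> mM my y1; exists (image_measure m my); split.
  by rewrite -mM.
apply/funext => z; rewrite /laplace (Rintegral_image_measure _ (M := 1))//.
- by apply: eq_Rintegral => x _; rewrite clamp_id.
- by rewrite mM ltry.
- exact: measurable_teich_clamp.
- exact: normr_teich_clamp_le1.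
Qed.

Lemma has_mass_ge0 f M : has_mass f M -> 0 <= M.
Proof. by move=> [nu [nuM _]]; rewrite -lee_fin -nuM. Qed.

Lemma has_mass_normr_le f M z : has_mass f M -> `|f z| <= M.
Proof.
move=> [nu [nuM ->]].
have := @Rintegral_norm_le _ _ _ nu (fun t => teich (clamp t) z) 1.
rewrite nuM mul1r; apply; first exact: ltry.
  exact: measurable_teich_clamp.
exact: normr_teich_clamp_le1.
Qed.

Lemma has_massD f g M N : has_mass f M -> has_mass g N -> has_mass (f + g) (M + N).
Proof.
move=> [nu [nuM ->]] [nv [nvN ->]]; exists (measure_add nu nv); split.
  by apply: (etrans (measure_addE nu nv setT)); rewrite nuM nvN.
apply/funext => z; rewrite /laplace (Rintegral_measure_add (M := 1)) ?nuM ?nvN ?ltry//.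
  exact: measurable_teich_clamp.
exact: normr_teich_clamp_le1.
Qed.

(** Since [s](z) [t](z) = [st](z), Fubini's theorem writes the product as an
    integral of the kernel over the product space: this is convolution of
    measures in the multiplicative variable. *)
Lemma has_massM f g M N : has_mass f M -> has_mass g N -> has_mass (f * g) (M * N).
Proof.
move=> [nu [nuM ->]] [nv [nvN ->]].
have nuf : (nu setT < +oo)%E by rewrite nuM ltry.
have nvf : (nv setT < +oo)%E by rewrite nvN ltry.
pose nu' := mfrestr measurableT nuf; pose nv' := mfrestr measurableT nvf.
pose y := fun x : R * R => clamp x.1 * clamp x.2.
have massE : (nu' \x nv')%E setT = (M * N)%:E.
  rewrite -setXTT; apply: (etrans (product_measure1E nu' nv' measurableT measurableT)).
  by rewrite /= /mfrestr /mrestr !setIT nuM nvN EFinM.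
have -> : laplace nu * laplace nv = fun z => \int[(nu' \x nv')%E]_x teich (y x) z.
  apply/funext => z.
  have iE (m : {measure set R -> \bar R}) (mfin : (m setT < +oo)%E) :
    \int[m]_t teich (clamp t) z = \int[mfrestr measurableT mfin]_t teich (clamp t) z.
    congr fine; apply: eq_measure_integral => A mA _.
    by rewrite /= /mfrestr /mrestr setIT.
  rewrite [LHS](_ : _ = laplace nu z * laplace nv z)// /laplace (iE nu nuf) (iE nv nvf).
  under [RHS]eq_Rintegral do rewrite /y teichM.
  rewrite {3}/Rintegral -integral12_prod_meas1; last first.
    apply: (integrable_bounded (f := fun u : R * R => _) (M := 1)) => //.
    - by apply: (@le_lt_trans _ _ (M * N)%:E); [rewrite -massE|exact: ltry].
    - by apply: measurable_funM; apply: (measurableT_comp (measurable_teich_clamp z)).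
    - by move=> u; rewrite normrM mulr_ile1 ?normr_teich_clamp_le1.
  have inu (m : {measure set R -> \bar R}) : (m setT < +oo)%E ->
      m.-integrable setT (EFin \o (fun t => teich (clamp t) z)).
    move=> mfin; apply: (integrable_bounded (M := 1)) => //.
      exact: measurable_teich_clamp.
    exact: normr_teich_clamp_le1.
  have nuf' : (nu' setT < +oo)%E by rewrite /nu' /= /mfrestr /mrestr setIT.
  have nvf' : (nv' setT < +oo)%E by rewrite /nv' /= /mfrestr /mrestr setIT.
  rewrite -(RintegralZr _ measurableT (inu _ nuf')).
  congr fine; apply: eq_integral => s _; rewrite /fubini_F/=.
  rewrite -(RintegralZl _ measurableT (inu _ nvf')) /Rintegral fineK//.
  apply: integrable_fin_num => //; apply: (integrable_bounded (f := fun u : R => _) (M := 1)) => //.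
    by apply: measurable_funM => //; exact: measurable_teich_clamp.
  by move=> u; rewrite normrM mulr_ile1 ?normr_teich_clamp_le1.
apply: (has_mass_image massE) => //.
- by apply: measurable_funM; apply: (measurableT_comp (@measurable_clamp R)).
- move=> x; rewrite normrM mulr_ile1 ?normr_clamp//.
Qed.

(** The constant c is the integral of [sgn c] = sgn c over an interval of
    length |c|. *)
Lemma has_mass_cst c : has_mass (cst c) `|c|.
Proof.
have -> : cst c = fun z => \int[mrestr lebesgue_measure (measurable_itv `[0, `|c|])]_x
    teich (Num.sg c) z.
  apply/funext => z; rewrite Rintegral_cst//= /mrestr setTI lebesgue_measure_itv/=.
  rewrite lte_fin teich_sg; case: ltP => [_|c0]; first by rewrite oppr0 addr0 -numEsg.
  by have /eqP -> : c == 0; [rewrite -normr_le0|rewrite sgr0 mul0r].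
apply: (has_mass_image (y := cst (Num.sg c))) => //.
- rewrite /= /mrestr setTI lebesgue_measure_itv/= lte_fin.
  case: ltP => [_|c0]; first by rewrite oppr0 adde0.
  by have /eqP -> : c == 0; [rewrite -normr_le0|rewrite normr0].
- by move=> x; exact: normr_sg_le1.
Qed.

(** Scaling is multiplication by a constant function. *)
Lemma has_massZ c f M : has_mass f M -> has_mass (c *: f) (`|c| * M).
Proof. by move=> fM; have := has_massM (has_mass_cst c) fM. Qed.

(** The sum of the measures is a measure, and its tail sums describe the
    remainders of the series of functions. *)
Lemma has_mass_series (g : nat -> {posnum R} -> R) (M : nat -> R) :
  (forall k, has_mass (g k) (M k)) -> (forall k, M k <= 2^-1 ^+ k) ->
  exists f, forall n, exists2 N,
    has_mass (f - \sum_(k < n) g k) N & N <= 2 * 2^-1 ^+ n.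
Proof.
move=> gM Mle.
have /choice[nu nuE] : forall k, exists nu : {measure set R -> \bar R},
  nu setT = (M k)%:E /\ g k = laplace nu by exact: gM.
pose mu n : {measure set R -> \bar R} := mseries nu n.
have muT n : (mu n setT <= (2 * 2^-1 ^+ n)%:E)%E.
  rewrite /= /mseries; apply: lime_le; first exact: is_cvg_nneseries.
  apply: nearW => m; under eq_bigr do rewrite (nuE _).1.
  rewrite sumEFin lee_fin; apply: le_trans (ler_sum_nat (fun k _ => Mle k)) _.
  have [nm|mn] := leqP n m; last by rewrite big_geq ?(ltnW mn)// mulr_ge0// exprn_ge0.
  suff -> : \sum_(n <= k < m) (2^-1 : R) ^+ k = 2 * 2^-1 ^+ n - 2 * 2^-1 ^+ m.
    by rewrite gerBl mulr_ge0// exprn_ge0.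
  elim: m nm => [|m IH]; first by rewrite leqn0 => /eqP ->; rewrite big_geq// subrr.
  rewrite leq_eqVlt => /predU1P[->|nm]; first by rewrite big_geq// subrr.
  by rewrite big_nat_recr//= IH// exprS; lra.
have mufin n : (mu n setT < +oo)%E by apply: le_lt_trans (muT n) (ltry _).
have muS n : mu n = measure_add (nu n) (mu n.+1).
  apply: eq_measure; apply/funext => A.
  apply/esym/(etrans (measure_addE (nu n) (mu n.+1) A)).
  by rewrite /= /mseries (nneseries_split n 1)// addn1 big_nat1.
exists (laplace (mu 0%N)) => n; exists (fine (mu n setT)); last first.
  by rewrite -lee_fin fineK// ge0_fin_numE.
exists (mu n); split; first by rewrite fineK// ge0_fin_numE.
elim: n => [|n IH]; first by rewrite big_ord0 subr0.
rewrite big_ord_recr/= opprD addrA IH muS.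
apply/funext => z.
rewrite [LHS](_ : _ = laplace (measure_add (nu n) (mu n.+1)) z - g n z)// (nuE n).2.
rewrite /laplace (Rintegral_measure_add (M := 1))//; first lra.
- by rewrite (nuE n).1 ltry.
- exact: measurable_teich_clamp.
- exact: normr_teich_clamp_le1.
Qed.

End laplace.

(** * Polynomials approximating a step *)

Section step_polynomials.
Context (R : realType).
Implicit Types (t w x : R).

Lemma bernoulli_ineq x n : -1 <= x -> 1 + n%:R * x <= (1 + x) ^+ n.
Proof.
move=> x1; elim: n => [|n IH]; first by rewrite mul0r addr0 expr0.
rewrite exprS; apply: le_trans (ler_wpM2l _ IH); last lra.
rewrite -natr1 -subr_ge0.
have -> : (1 + x) * (1 + n%:R * x) - (1 + (n%:R + 1) * x) = n%:R * x ^+ 2 by ring.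
by rewrite mulr_ge0// sqr_ge0.
Qed.

Lemma cvg_natrX w : 0 <= w < 1 -> (n%:R * w ^+ n @[n --> \oo] --> 0).
Proof.
move=> /andP[w0 w1].
have [->|wn0] := eqVneq w 0.
  apply: cvg_near_cst; near=> n.
  by rewrite expr0n gtn_eqF ?mulr0//; near: n; exact: nbhs_infty_gt.
have wp : 0 < w by rewrite lt_neqAle eq_sym wn0.
(* Write w as v ^ 2: half of the decay absorbs the factor n. *)
pose v := Num.sqrt w.
have v0 : 0 < v by rewrite sqrtr_gt0.
have v1 : v < 1 by rewrite -sqrtr1 ltr_sqrt.
have vw n : w ^+ n = v ^+ n * v ^+ n by rewrite -exprMn -expr2 sqr_sqrtr.
pose C := (v^-1 - 1)^-1.
have C0 : 0 < v^-1 - 1 by rewrite subr_gt0 invf_gt1.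
have nv n : n%:R * v ^+ n <= C.
  rewrite /C -[leRHS]mul1r ler_pdivlMr// mulrAC -ler_pdivlMr ?exprn_gt0//.
  rewrite div1r -exprVn; have := @bernoulli_ineq (v^-1 - 1) n.
  rewrite addrCA subrr addr0 => h; apply: le_trans (h _); [lra|lra].
apply: (@squeeze_cvgr _ _ _ _ (cst 0) (fun n => C * v ^+ n)).
- near=> n; rewrite /= mulr_ge0 ?exprn_ge0//= vw mulrA.
  by rewrite ler_wpM2r// exprn_ge0// ltW.
- exact: cvg_cst.
- rewrite -[X in _ --> X](mulr0 C); apply: cvgMr; apply: cvg_expr.
  by rewrite gtr0_norm.
Unshelve. all: by end_near.
Qed.

(** Polynomials in t with values in [0, 1] on [0, 1], converging pointwise to
    the indicator of t < 1/2.  With exponent 2 ^ n instead of n 2 ^ n the limit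
    at t = 1/2 would be 1/e; the factor n sends it to 0, and it is too
    small to matter for t < 1/2. *)
Definition step n t := (1 - t ^+ n) ^+ (n * 2 ^ n).

Lemma step_itv01 n t : 0 <= t <= 1 -> 0 <= step n t <= 1.
Proof.
move=> /andP[t0 t1].
have [h0 h1] : 0 <= t ^+ n /\ t ^+ n <= 1 by rewrite exprn_ge0// exprn_ile1.
by rewrite exprn_ge0 ?exprn_ile1//; lra.
Qed.

(** Bernoulli's inequality gives the lower bound 1 - n (2t)^n. *)
Lemma step_cvg1 t : 0 <= t < 2^-1 -> step n t @[n --> \oo] --> (1 : R).
Proof.
move=> /andP[t0 t1].
apply: (@squeeze_cvgr _ _ _ _ (fun n => 1 - n%:R * (2 * t) ^+ n) (cst 1)).
- apply: nearW => n /=; have /andP[_ ->] := @step_itv01 n t ltac:(lra).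
  rewrite andbT /step; have := @bernoulli_ineq (- t ^+ n) (n * 2 ^ n).
  rewrite natrM natrX exprMn mulrN !mulrA => h; apply: h.
  by rewrite lerN2 exprn_ile1//; lra.
- rewrite -[X in _ --> X](subr0 (1 : R)); apply: cvgB; first exact: cvg_cst.
  by apply: cvg_natrX; lra.
- exact: cvg_cst.
Qed.

(** The product of (1 - t^n)^k and (1 + t^n)^k is at most 1, and the second
    factor is at least 1 + n for k = n 2^n by Bernoulli's inequality. *)
Lemma step_cvg0 t : 2^-1 <= t <= 1 -> step n t @[n --> \oo] --> (0 : R).
Proof.
move=> /andP[t0 t1].
apply: (@squeeze_cvgr _ _ _ _ (cst 0) (fun n => n.+1%:R^-1)).
- apply: nearW => n /=; have /andP[s0 _] := @step_itv01 n t ltac:(lra).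
  rewrite s0/= -div1r ler_pdivlMr//.
  have h : n.+1%:R <= (1 + t ^+ n) ^+ (n * 2 ^ n).
    apply: le_trans (@bernoulli_ineq (t ^+ n) (n * 2 ^ n) _); last first.
      by apply: (@le_trans _ _ 0); rewrite ?exprn_ge0 ?lerN10//; lra.
    rewrite natrM natrX -mulrA -exprMn -natr1 addrC lerD2l ler_peMr//.
    by rewrite exprn_ege1//; lra.
  apply: le_trans (ler_wpM2l s0 h) _; rewrite /step -exprMn -subr_sqr expr1n.
  have [h0 h1] : 0 <= t ^+ n /\ t ^+ n <= 1 by rewrite exprn_ge0 ?exprn_ile1//; lra.
  by rewrite exprn_ile1//; nra.
- exact: cvg_cst.
- exact: cvg_harmonic.
Qed.

End step_polynomials.

(** * Moments determine a finite measure *)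

Section moments.
Context (R : realType).
Implicit Types (m : {measure set R -> \bar R}).

Lemma eq_measure_rays m1 m2 : (m1 setT < +oo)%E ->
  (forall a : R, m1 `]a, +oo[%classic = m2 `]a, +oo[%classic) ->
  forall A, measurable A -> m1 A = m2 A.
Proof.
move=> m1fin m12; apply: (measure_unique (@RGenOInfty.G R) (fun k => `](- k%:R), +oo[%classic)).
- exact: RGenOInfty.measurableE.
- move=> _ _ [a ->] [b ->]; exists (Num.max a b).
  by apply/seteqP; split => x /=; rewrite !in_itv/= !andbT gt_max => /andP.
- by move=> k; eexists.
- rewrite -subTset => x _; exists (Num.trunc `|x|).+1 => //=.
  rewrite in_itv/= andbT ltrNl; apply: le_lt_trans (truncnS_gt _).
  by rewrite -normrN ler_norm.
- by move=> _ [a ->]; exact: m12.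
- by move=> k; apply: le_lt_trans m1fin; rewrite le_measure// inE.
Qed.

(** By induction on the polynomial; the statement is strengthened in the proof
    with an extra power of the variable, to pass through p |-> p 'X + c. *)
Lemma Rintegral_poly_clamp m1 m2 : (m1 setT < +oo)%E -> (m2 setT < +oo)%E ->
  (forall k, \int[m1]_t clamp t ^+ k = \int[m2]_t clamp t ^+ k) ->
  forall p : {poly R}, \int[m1]_t p.[clamp t] = \int[m2]_t p.[clamp t].
Proof.
move=> m1fin m2fin mk p.
have mX k : measurable_fun setT (fun t : R => clamp t ^+ k).
  by apply: measurable_funX; exact: measurable_clamp.
have mp (q : {poly R}) : measurable_fun setT (fun t : R => q.[clamp t]).
  under eq_fun do rewrite horner_coef.
  by apply: measurable_sum => i; apply: measurable_funM.
pose C (q : {poly R}) := \sum_(i < size q) `|q`_i|.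
have X1 k t : `|clamp t ^+ k : R| <= 1 by rewrite normrX exprn_ile1// normr_clamp.
have bp (q : {poly R}) t : `|q.[clamp t]| <= C q.
  rewrite horner_coef; apply: le_trans (ler_norm_sum _ _ _) _.
  by apply: ler_sum => i _; rewrite normrM ler_piMr.
have iX (m : {measure set R -> \bar R}) k : (m setT < +oo)%E ->
    m.-integrable setT (EFin \o (fun t => clamp t ^+ k)).
  by move=> mfin; apply: (integrable_bounded (M := 1)).
have ipX (m : {measure set R -> \bar R}) (q : {poly R}) k : (m setT < +oo)%E ->
    m.-integrable setT (EFin \o (fun t => q.[clamp t] * clamp t ^+ k)).
  move=> mfin; apply: (integrable_bounded (M := C q)) => //.
    exact: measurable_funM.
  by move=> t; rewrite normrM -[leRHS]mulr1 ler_pM.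
suff H k : \int[m1]_t (p.[clamp t] * clamp t ^+ k) =
           \int[m2]_t (p.[clamp t] * clamp t ^+ k).
  by have := H 0%N; under eq_Rintegral do rewrite expr0 mulr1;
     under [RHS]eq_Rintegral do rewrite expr0 mulr1.
elim/poly_ind: p k => [k|p c IH k].
  by under eq_Rintegral do rewrite horner0 mul0r;
     under [RHS]eq_Rintegral do rewrite horner0 mul0r; rewrite !Rintegral_cst// !mul0r.
have E (m : {measure set R -> \bar R}) : (m setT < +oo)%E ->
    \int[m]_t ((p * 'X + c%:P).[clamp t] * clamp t ^+ k) =
    \int[m]_t (p.[clamp t] * clamp t ^+ k.+1) + c * \int[m]_t clamp t ^+ k.
  move=> mfin; rewrite -RintegralZl//; last exact: iX.
  rewrite -RintegralD//; [|exact: ipX|].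
    by apply: eq_Rintegral => t _; rewrite !hornerE exprS; ring.
  exact: integrableZl (iX _ _ mfin).
by rewrite !E// IH mk.
Qed.

(** The measure of a ray is the limit of integrals of polynomials, by dominated
    convergence along the step polynomials after an affine change of variable. *)
Lemma eq_moments_image_clamp m1 m2 : (m1 setT < +oo)%E -> (m2 setT < +oo)%E ->
  (forall k, \int[m1]_t clamp t ^+ k = \int[m2]_t clamp t ^+ k) ->
  forall A, measurable A -> m1 (@clamp R @^-1` A) = m2 (@clamp R @^-1` A).
Proof.
move=> m1fin m2fin mk.
have mc := @measurable_clamp R.
apply: (@eq_measure_rays (image_measure m1 mc) (image_measure m2 mc)) => // a.
rewrite /image_measure/= /pushforward.
have mclamp (A : set R) : measurable A -> measurable (@clamp R @^-1` A).
  by move=> mA; rewrite -[X in measurable X]setTI; exact: mc.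
have [a1|a1] := ltP a (-1).
  rewrite (_ : _ @^-1` _ = setT).
    have := mk 0%N; under eq_Rintegral do rewrite expr0.
    under [RHS]eq_Rintegral do rewrite expr0.
    rewrite !Rintegral_cst// !mul1r => h; have := congr1 (@EFin R) h.
    by rewrite !fineK// ge0_fin_numE.
  apply/seteqP; split => // t _ /=; rewrite in_itv/= andbT (lt_le_trans a1)//.
  by have := normr_clamp t; rewrite ler_norml => /andP[].
have [a2|a2] := leP 1 a.
  rewrite (_ : _ @^-1` _ = set0) ?measure0//.
  apply/seteqP; split => // t /=; rewrite in_itv/= andbT ltNge => /negP; apply.
  by apply: le_trans a2; have := normr_clamp t; rewrite ler_norml => /andP[].
(* An affine map sending [-1, 1] into [0, 1], and the ray above a to the values
   below 1/2. *)
pose u (t : R) := 2^-1 - (clamp t - a) / 4.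
have u01 t : 0 <= u t <= 1.
  have := normr_clamp t; rewrite ler_norml /u => /andP[c1 c2]; lra.
pose I (t : R) : R := \1_(`]a, +oo[%classic) (clamp t).
have mI : measurable_fun setT I by apply: measurableT_comp.
pose q n : {poly R} := (1 - ((2^-1 + a / 4)%:P - (4^-1)%:P * 'X) ^+ n) ^+ (n * 2 ^ n).
have qE n t : (q n).[clamp t] = step n (u t).
  rewrite /q /step horner_exp hornerD hornerN hornerC horner_exp.
  by rewrite hornerD hornerN hornerM !hornerC hornerX /u; congr ((1 - _ ^+ _) ^+ _); lra.
have mstep n : measurable_fun setT (fun t => step n (u t)).
  apply: measurable_funX; apply: measurable_funB => //; apply: measurable_funX.
  apply: measurable_funB => //; apply: measurable_funM => //.
  exact: measurable_funB.
have cvgI t : step n (u t) @[n --> \oo] --> I t.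
  rewrite /I indicE; case: (ltP a (clamp t)) => act.
    rewrite mem_set/=; last by rewrite /= in_itv/= andbT.
    by apply: step_cvg1; have := u01 t; rewrite /u; lra.
  rewrite memNset/=; last by rewrite /= in_itv/= andbT; apply/negP; rewrite -leNgt.
  by apply: step_cvg0; have := u01 t; rewrite /u; lra.
have key (m : {measure set R -> \bar R}) : (m setT < +oo)%E ->
    (\int[m]_t (step n (u t))%:E)%E @[n --> \oo] --> m (@clamp R @^-1` `]a, +oo[%classic).
  move=> mfin.
  have -> : m (@clamp R @^-1` `]a, +oo[%classic) = (\int[m]_t (I t)%:E)%E.
    rewrite -[in LHS](setIT (_ @^-1` _)) -integral_indic//; last exact: mclamp.
  have := @dominated_convergence _ _ _ m setT measurableT
    (fun n t => (step n (u t))%:E) (fun t => (I t)%:E) (cst 1%E).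
  case => //.
  - by move=> n; apply/measurable_EFinP.
  - by apply/measurable_EFinP.
  - by apply: aeW => t _; apply/cvg_EFin; [exact: nearW|exact: cvgI].
  - by apply: (integrable_bounded (f := cst 1) (M := 1)) => // ?; rewrite normr1.
  - apply: aeW => t n _; rewrite lee_fin ger0_norm.
      by have /andP[] := step_itv01 n (u01 t).
    by have /andP[] := step_itv01 n (u01 t).
rewrite -(cvg_lim (@ereal_hausdorff R) (key m1 m1fin)).
rewrite -(cvg_lim (@ereal_hausdorff R) (key m2 m2fin)).
congr (lim (_ @ \oo)); apply/funext => n.
have ifin (m : {measure set R -> \bar R}) : (m setT < +oo)%E ->
    (\int[m]_t (step n (u t))%:E)%E = (\int[m]_t (q n).[clamp t])%:E.
  move=> mfin; rewrite /Rintegral fineK; first by under [RHS]eq_integral do rewrite qE.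
  under eq_integral do rewrite qE.
  apply: integrable_fin_num => //; apply: (integrable_bounded (M := 1)) => //.
  by move=> t; have /andP[s0 s1] := step_itv01 n (u01 t); rewrite ger0_norm.
by rewrite !ifin// (Rintegral_poly_clamp m1fin m2fin mk).
Qed.

End moments.

(** * The transform determines integrals of odd functions *)

Section odd_test_functions.
Context (R : realType).
Implicit Types (m eta nu : {measure set R -> \bar R}).

(** At an odd integer the sign is reproduced by the power, so that the values of
    a transform there are moments of the measure. *)
Lemma teich_odd_nat (t : R) (k : nat) (z : {posnum R}) : z%:num = k.*2.+1%:R ->
  teich t z = t ^+ k.*2.+1.
Proof.
move=> zk; rewrite /teich zk powR_mulrn//.
rewrite [in RHS](numEsg t) exprMn; congr (_ * _).
have [->|t0] := eqVneq t 0; first by rewrite sgr0 expr0n.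
by rewrite exprS -mul2n exprM sqr_sg t0 expr1n mulr1.
Qed.

(** The reflections of the two measures are exchanged to kill the discrepancy
    between the even moments, about which the transforms say nothing. *)
Lemma Rintegral_odd_laplace eta nu (phi : R -> R) (M : R) :
  (eta setT < +oo)%E -> (nu setT < +oo)%E ->
  laplace eta = laplace nu ->
  measurable_fun setT phi -> (forall t, phi (- t) = - phi t) ->
  (forall t, `|phi t| <= M) ->
  \int[eta]_t phi (clamp t) = \int[nu]_t phi (clamp t).
Proof.
move=> etafin nufin etanu mphi phiN phiM.
have mN : measurable_fun setT (@GRing.opp R) by [].
have mc := @measurable_clamp R.
pose neg m := image_measure m mN.
have negfin m : (m setT < +oo)%E -> (neg m setT < +oo)%E by [].
pose sym m1 m2 : {measure set R -> \bar R} := measure_add m1 (neg m2).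
have symfin m1 m2 : (m1 setT < +oo)%E -> (m2 setT < +oo)%E -> (sym m1 m2 setT < +oo)%E.
  move=> h1 h2; rewrite /sym [X in (X < _)%E](measure_addE m1 (neg m2) setT).
  by rewrite lte_add_pinfty// negfin.
have symE m1 m2 (g : R -> R) N : (m1 setT < +oo)%E -> (m2 setT < +oo)%E ->
    measurable_fun setT g -> (forall t, `|g (clamp t)| <= N) ->
    \int[sym m1 m2]_t g (clamp t) = \int[m1]_t g (clamp t) + \int[m2]_t g (- clamp t).
  move=> h1 h2 mg gN.
  have mgc : measurable_fun setT (fun t => g (clamp t)) by exact: measurableT_comp mg mc.
  rewrite /sym (Rintegral_measure_add (M := N))//.
  rewrite /neg (Rintegral_image_measure _ (M := N))//.
  by congr (_ + _); apply: eq_Rintegral => t _; rewrite clampN.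
have moments k : \int[sym eta nu]_t clamp t ^+ k = \int[sym nu eta]_t clamp t ^+ k.
  have mX : measurable_fun setT (fun t : R => t ^+ k) by exact: measurable_funX.
  have X1 t : `|clamp t ^+ k : R| <= 1 by rewrite normrX exprn_ile1// normr_clamp.
  rewrite !(symE _ _ (fun t => t ^+ k) 1)//.
  have [ko|ke] := boolP (odd k); last first.
    rewrite addrC; congr (_ + _); apply: eq_Rintegral => t _;
      by rewrite exprNn -signr_odd (negPf ke) mul1r.
  pose z : {posnum R} := PosNum (ltr0Sn R k.-1).
  have kE : k = k./2.*2.+1 by rewrite -[LHS]odd_double_half ko.
  have E m : \int[m]_t clamp t ^+ k = laplace m z.
    apply: eq_Rintegral => t _; rewrite (@teich_odd_nat _ k./2) -?kE//.
    by rewrite /z/= prednK// kE.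
  have EN m : (m setT < +oo)%E -> \int[m]_t (- clamp t) ^+ k = - laplace m z.
    move=> mfin; under eq_Rintegral do rewrite exprNn -signr_odd ko expr1.
    rewrite RintegralZl ?mulN1r ?E//; apply: (integrable_bounded (M := 1)) => //.
    exact: (measurableT_comp mX mc).
  by rewrite !E !EN// etanu addrC.
have symeq := eq_moments_image_clamp (symfin _ _ etafin nufin) (symfin _ _ nufin etafin) moments.
have : \int[sym eta nu]_t phi (clamp t) = \int[sym nu eta]_t phi (clamp t).
  rewrite -!(Rintegral_image_measure mc (M := M)) ?symfin//.
  by congr fine; apply: eq_measure_integral => A mA _; exact: symeq.
rewrite !(symE _ _ _ M)//.
have EN m : (m setT < +oo)%E -> \int[m]_t phi (- clamp t) = - \int[m]_t phi (clamp t).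
  move=> mfin; under eq_Rintegral do rewrite phiN -mulN1r.
  rewrite RintegralZl ?mulN1r//; apply: (integrable_bounded (M := M)) => //.
  exact: (measurableT_comp mphi mc).
by rewrite !EN//; lra.
Qed.

End odd_test_functions.

(** * Tropical families and their supports *)

Section initial_segments.
Context (R : realType).
Notation leb := (@lebesgue_measure R).

Lemma lebesgue_itv0_lty (V : R) : (leb `[0%R, V] < +oo)%E.
Proof. by rewrite lebesgue_measure_itv; case: ifP => // _; rewrite ltry. Qed.

Lemma lebesgue_itv0 (V : R) : 0 <= V -> leb `[0%R, V] = V%:E.
Proof.
rewrite lebesgue_measure_itv/= lte_fin le_eqVlt => /predU1P[<-|->].
  by rewrite ltxx.
by rewrite oppr0 adde0.
Qed.

Lemma lebesgue_itv0o (V : R) : 0 <= V -> leb `[0%R, V[ = V%:E.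
Proof.
rewrite lebesgue_measure_itv/= lte_fin le_eqVlt => /predU1P[<-|->].
  by rewrite ltxx.
by rewrite oppr0 adde0.
Qed.

(** An initial segment of [0, V] is determined by its length, up to its right
    endpoint. *)
Lemma downset_length (V w : R) (D : set R) : measurable D -> D `<=` `[0, V]%classic ->
  (forall u v, D v -> 0 <= u <= v -> D u) -> 0 <= w ->
  (D w -> w <= fine (leb D)) /\ (~ D w -> fine (leb D) <= w).
Proof.
move=> mD DV Ddown w0.
have Dfin : leb D \is a fin_num.
  rewrite ge0_fin_numE//; apply: le_lt_trans (lebesgue_itv0_lty V).
  by rewrite le_measure// inE.
split=> [Dw|nDw]; rewrite -lee_fin fineK// -(lebesgue_itv0 w0); rewrite le_measure ?inE// => u.
  by rewrite /= in_itv/=; exact: Ddown.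
move=> Du; have := DV _ Du; rewrite /= !in_itv/= => /andP[u0 _]; rewrite u0/= leNgt.
by apply/negP => wu; apply: nDw; apply: Ddown Du _; rewrite w0 ltW.
Qed.

End initial_segments.

Section tropical_families.
Context (R : realType) (V : R) (x : R -> R) (trop : tropical_family V x).
Notation leb := (@lebesgue_measure R).

Let I : set R := `[0, V]%classic.
Let mI : measurable I. Proof. exact: measurable_itv. Qed.
Let V0 : 0 <= V. Proof. by case: trop. Qed.
(** The family extended by 0, so as to be measurable on the whole line. *)
Let y : R -> R := x \_ I.

Let my : measurable_fun setT y.
Proof. by apply/(measurable_restrictT _ mI); case: trop. Qed.

Let yE u : u \in `[0, V] -> y u = x u.
Proof. by move=> uI; rewrite /y patchE mem_set. Qed.

Let y1 u : `|y u| <= 1.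
Proof.
rewrite /y patchE; case: ifPn => [|_]; last by rewrite normr0.
by rewrite inE => uI; case: trop => _ _ /(_ u uI); rewrite in_itv/= ler_norml.
Qed.

Let smile u v : u \in `[0, V] -> v \in `[0, V] -> u <= v -> smile_absorbs (x u) (x v).
Proof. by case: trop => _ _ _; apply. Qed.

Let m : {measure set (measurableTypeR R) -> \bar R} := mrestr leb mI.

Let mT : m setT = V%:E.
Proof. by rewrite /m /= /mrestr setTI lebesgue_itv0. Qed.

Lemma tropical_integralE :
  tropical_integral V x = fun z => \int[m]_u teich (y u) z.
Proof.
apply/funext => z; rewrite /m (Rintegral_mrestr _ (M := 1)) ?lebesgue_itv0_lty//.
- by apply: eq_Rintegral => u; rewrite inE => uI; rewrite yE.
- exact: measurableT_comp (measurable_teich z) my.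
- by move=> u; exact: normr_teich_le1.
Qed.

Let supp := [set u : R | u \in `[0, V] /\ x u != 0].

Let suppE : supp = [set u | y u != 0].
Proof.
apply/seteqP; split => u /=; first by move=> [uI]; rewrite yE.
rewrite /y patchE; case: ifPn => [|_]; last by rewrite eqxx.
by rewrite inE.
Qed.

Let msupp : measurable supp.
Proof.
rewrite suppE -[X in measurable X]setTI.
apply: (my measurableT (Y := [set t : R | t != 0])).
by rewrite (_ : mkset _ = ~` [set 0]); [exact: measurableC|apply/seteqP; split => t /= /eqP].
Qed.

Lemma support_sup_ge0 : 0 <= support_sup V x.
Proof.
rewrite /support_sup -/supp; have [->|/set0P[u [uI xu]]] := eqVneq supp set0; first by rewrite sup0.
have := uI; rewrite in_itv/= => /andP[u0 _]; apply: le_trans u0 _.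
apply: ub_le_sup; last by split.
by exists V => w [+ _]; rewrite in_itv/= => /andP[].
Qed.

(** Since |x_u| is nonincreasing, the support is an initial segment. *)
Lemma lebesgue_support : leb supp = (support_sup V x)%:E.
Proof.
have S0 := support_sup_ge0.
have ubV : has_ubound supp by exists V => w [+ _]; rewrite in_itv/= => /andP[].
apply/eqP; rewrite eq_le; apply/andP; split.
  rewrite -(lebesgue_itv0 S0); apply: le_measure; rewrite ?inE// => u su.
  rewrite /= in_itv/= (ub_le_sup ubV su) andbT.
  by case: su => + _; rewrite in_itv/= => /andP[].
rewrite -(lebesgue_itv0o S0); apply: le_measure; rewrite ?inE// => u.
rewrite /= in_itv/= => /andP[u0 uS].
have supp0 : supp !=set0.
  by apply/set0P/eqP => s0; move: uS; rewrite /support_sup -/supp s0 sup0 ltNge u0.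
have [w [wI xw] uw] := sup_gt supp0 uS.
have uI : u \in `[0, V].
  move: wI; rewrite !in_itv/= => /andP[_ wV]; rewrite u0/=.
  by apply: ltW; exact: lt_le_trans uw wV.
split => //; have [h _] := smile uI wI (ltW uw).
by rewrite -normr_gt0; apply: lt_le_trans h; rewrite normr_gt0.
Qed.

Lemma tropical_integral_has_mass : has_mass (tropical_integral V x) (support_sup V x).
Proof.
have Sfin : (leb supp < +oo)%E by rewrite lebesgue_support ltry.
have -> : tropical_integral V x = fun z => \int[mrestr leb msupp]_u teich (y u) z.
  apply/funext => z; have mt := measurableT_comp (measurable_teich z) my.
  have t1 u : `|teich (y u) z| <= 1 by exact: normr_teich_le1.
  rewrite tropical_integralE.
  rewrite /m (Rintegral_mrestr _ (M := 1))//; last exact: lebesgue_itv0_lty.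
  rewrite (Rintegral_mrestr _ (M := 1))//.
  rewrite Rintegral_mkcond [RHS]Rintegral_mkcond; apply: eq_Rintegral => u _.
  rewrite !patchE; case: ifPn => uI; case: ifPn => //; rewrite ?notin_setE ?inE.
    rewrite suppE /= => /negP; rewrite negbK => /eqP ->.
    by rewrite /teich sgr0 mul0r.
  by move=> [uI' _]; move: uI; rewrite notin_setE.
apply: has_mass_image => //.
by rewrite /= /mrestr setTI lebesgue_support.
Qed.

Let lev (t : R) := [set u | `[0, V]%classic u /\ t <= `|y u|].
Let slev (t : R) := [set u | `[0, V]%classic u /\ t < `|y u|].

(** For a value t of |x|, the midpoint of the interval of all u with
    |x_u| = t. *)
Let mid t := (fine (leb (lev t)) + fine (leb (slev t))) / 2.

Let mnormy : measurable_fun setT (fun u => `|y u|).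
Proof. exact: measurableT_comp (@normr_measurable R setT) my. Qed.

Let mlev t : measurable (lev t).
Proof.
rewrite (_ : lev t = I `&` (fun u => `|y u|) @^-1` `[t, +oo[%classic).
  by apply: measurableI => //; rewrite -[X in measurable X]setTI; exact: mnormy.
by apply/seteqP; split => u /= [uI]; rewrite in_itv/= ?andbT.
Qed.

Let mslev t : measurable (slev t).
Proof.
rewrite (_ : slev t = I `&` (fun u => `|y u|) @^-1` `]t, +oo[%classic).
  by apply: measurableI => //; rewrite -[X in measurable X]setTI; exact: mnormy.
by apply/seteqP; split => u /= [uI]; rewrite in_itv/= ?andbT.
Qed.

Let antitone u v : u \in `[0, V] -> v \in `[0, V] -> u <= v -> `|y v| <= `|y u|.
Proof. by move=> uI vI uv; rewrite !yE//; case: (smile uI vI uv). Qed.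

Let mmid : measurable_fun setT mid.
Proof.
have fin D : measurable D -> D `<=` I -> leb D \is a fin_num.
  move=> mD DI; rewrite ge0_fin_numE//; apply: le_lt_trans (lebesgue_itv0_lty V).
  by rewrite le_measure// inE.
apply: nonincreasing_measurable => // s t st; rewrite /mid ler_pM2r//.
have finl r : leb (lev r) \is a fin_num by apply: fin => // u [].
have fins r : leb (slev r) \is a fin_num by apply: fin => // u [].
apply: lerD; apply: fine_le => //; apply: le_measure; rewrite ?inE//.
- exact: mlev.
- exact: mlev.
- by move=> u [uI ty]; split => //; apply: le_trans st ty.
- exact: mslev.
- exact: mslev.
- by move=> u [uI ty]; split => //; apply: le_lt_trans st ty.
Qed.

(** So x_u is a Borel function of |x_u|: either u is alone in its level set and
    is its midpoint, or the midpoint is interior to the level set, on which the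
    tropical condition makes the family constant. *)
Let x_mid u : u \in `[0, V] -> y (mid `|x u|) = x u.
Proof.
move=> uI; set t := `|x u|.
have u0 : 0 <= u by move: uI; rewrite in_itv/= => /andP[].
have down w v : `[0, V]%classic v -> 0 <= w <= v -> w \in `[0, V].
  by rewrite /= !in_itv/= => /andP[v0 vV] /andP[-> /le_trans ->].
have L w : 0 <= w ->
    (lev t w -> w <= fine (leb (lev t))) /\ (~ lev t w -> fine (leb (lev t)) <= w).
  apply: (downset_length (V := V) (mlev t)) => //; first by move=> v [].
  move=> a b [bI tb] ab; have aI := down _ _ bI ab; split => //.
  by apply: le_trans tb _; apply: antitone => //; case/andP: ab.
have S w : 0 <= w ->
    (slev t w -> w <= fine (leb (slev t))) /\ (~ slev t w -> fine (leb (slev t)) <= w).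
  apply: (downset_length (V := V) (mslev t)) => //; first by move=> v [].
  move=> a b [bI tb] ab; have aI := down _ _ bI ab; split => //.
  by apply: lt_le_trans tb _; apply: antitone => //; case/andP: ab.
have uL : u <= fine (leb (lev t)) by apply: (L u u0).1; split; rewrite ?yE.
have Su : fine (leb (slev t)) <= u.
  by apply: (S u u0).2 => -[_]; rewrite yE// ltxx.
have S0 : 0 <= fine (leb (slev t)) by exact: fine_ge0.
have [E|ne] := eqVneq (fine (leb (slev t))) (fine (leb (lev t))).
  have -> : mid t = u by rewrite /mid; lra.
  by rewrite yE.
have SL : fine (leb (slev t)) < fine (leb (lev t)) by rewrite lt_neqAle ne (le_trans Su).
have M0 : 0 <= mid t by rewrite /mid; lra.
have [MI Mge] : lev t (mid t).
  by apply: contrapT => /(L _ M0).2; rewrite /mid; lra.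
have Mle : `|y (mid t)| <= t.
  rewrite leNgt; apply/negP => tM; have : slev t (mid t) by split.
  by move=> /(S _ M0).1; rewrite /mid; lra.
have Mt : `|x (mid t)| = `|x u| by apply/eqP; rewrite -(yE MI) eq_le Mle.
rewrite (yE MI); have [uM|/ltW Mu] := leP u (mid t).
  by have [_ h] := smile uI MI uM; rewrite h.
by have [_ h] := smile MI uI Mu; rewrite h.
Qed.

(** No description of the function is more economical than the tropical one:
    the odd function phi below is bounded by 1, and phi(x_u) = 1 for every u in
    the support. *)
Lemma support_sup_le_mass M : has_mass (tropical_integral V x) M -> support_sup V x <= M.
Proof.
move=> [nu [nuM fnu]].
have nufin : (nu setT < +oo)%E by rewrite nuM ltry.
pose eta := image_measure m my.
have etafin : (eta setT < +oo)%E by rewrite (_ : eta setT = V%:E) ?ltry.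
pose phi (t : R) := Num.sg (y (mid `|t|)) * Num.sg t.
have msg := @measurable_sg R.
have mphi : measurable_fun setT phi.
  apply: measurable_funM => //; apply: (measurableT_comp msg).
  apply: (measurableT_comp my); apply: (measurableT_comp mmid).
  exact: normr_measurable.
have phi1 t : `|phi t| <= 1 by rewrite normrM mulr_ile1 ?normr_sg_le1.
have phiN t : phi (- t) = - phi t by rewrite /phi normrN sgrN mulrN.
have etanu : laplace eta = laplace nu.
  rewrite -fnu tropical_integralE; apply/funext => z.
  rewrite /laplace (Rintegral_image_measure _ (M := 1)) ?mT ?ltry//.
  - by apply: eq_Rintegral => u _; rewrite clamp_id.
  - exact: measurable_teich_clamp.
  - exact: normr_teich_clamp_le1.
have := Rintegral_odd_laplace etafin nufin etanu mphi phiN phi1.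
rewrite (Rintegral_image_measure _ (g := fun t => phi (clamp t)) (M := 1)) ?mT ?ltry//; last first.
  exact: (measurableT_comp mphi (@measurable_clamp R)).
have -> : \int[m]_u phi (clamp (y u)) = support_sup V x.
  rewrite /m (Rintegral_mrestr _ (M := 1)) ?lebesgue_itv0_lty//; last first.
    apply: (measurableT_comp mphi (measurableT_comp (@measurable_clamp R) my)).
  transitivity (\int[leb]_(u in I) \1_supp u).
    apply: eq_Rintegral => u; rewrite inE => uI; rewrite clamp_id// yE//.
    rewrite /phi x_mid// -expr2 sqr_sg indicE; congr (_%:R); apply/esym.
    have [xu|xu] /= := boolP (x u != 0); first by rewrite mem_set.
    by rewrite memNset// => -[_]; rewrite (negPf xu).
  rewrite /Rintegral integral_indic// setIidl; last by move=> u [].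
  exact: (congr1 fine lebesgue_support).
move=> ->; apply: le_trans (ler_norm _) _.
rewrite -[leRHS](_ : 1 * fine (nu setT) = _); last by rewrite nuM mul1r.
apply: Rintegral_norm_le => //.
exact: (measurableT_comp mphi (@measurable_clamp R)).
Qed.

End tropical_families.

(** * Jordan decomposition and quantiles *)

(** The Hahn and Jordan decompositions of m1 - m2, with the identity
    m1 - m2 = jp - jn written without subtraction, as one between measures.
    The last clause locates jp and jn where m1 or m2 lives. *)
Lemma Jordan_difference d (T : measurableType d) (R : realType)
    (m1 m2 : {measure set T -> \bar R}) :
  (m1 setT < +oo)%E -> (m2 setT < +oo)%E ->
  exists (P : set T) (jp jn : {measure set T -> \bar R}),
    [/\ measurable P, (jp setT < +oo)%E /\ (jn setT < +oo)%E,
        jp (~` P) = 0%E /\ jn P = 0%E,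
        (forall A, measurable A -> (m1 A + jn A = m2 A + jp A)%E) &
        forall A, measurable A -> m1 A = 0%E -> m2 A = 0%E -> jp A = 0%E /\ jn A = 0%E].
Proof.
move=> f1 f2.
pose c1 := charge_of_finite_measure (mfrestr measurableT f1).
pose c2 := charge_of_finite_measure (mfrestr measurableT f2).
pose rho : {charge set T -> \bar R} := cadd c1 (copp c2).
have [P [N PN]] := Hahn_decomposition rho.
have [[mP _] [mN _] PNT PN0] := PN.
have rhoE A : rho A = (m1 A - m2 A)%E.
  have c2E : c2 A = m2 A by rewrite /c2 /charge_of_finite_measure /= /mfrestr /mrestr setIT.
  have c1E : c1 A = m1 A by rewrite /c1 /charge_of_finite_measure /= /mfrestr /mrestr setIT.
  by change (c1 A - c2 A = m1 A - m2 A)%E; rewrite c1E c2E.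
have NP : ~` P = N.
  apply/seteqP; split => t /=; first by move: (I : setT t); rewrite -PNT => -[].
  by move=> Nt Pt; have : (P `&` N) t by []; rewrite PN0.
pose jp : {measure set T -> \bar R} := jordan_pos PN.
pose jn : {measure set T -> \bar R} := jordan_neg PN.
have jpE A : measurable A -> jp A = rho (A `&` P).
  by move=> mA; rewrite /jp /= jordan_posE cjordan_posE /crestr0 mem_set.
have jnE A : measurable A -> jn A = (- rho (A `&` N))%E.
  by move=> mA; rewrite /jn /= jordan_negE cjordan_negE /crestr0 mem_set.
have fin (m : {measure set T -> \bar R}) A :
    (m setT < +oo)%E -> measurable A -> m A \is a fin_num.
  move=> mfin mA; rewrite ge0_fin_numE//; apply: le_lt_trans mfin.
  by rewrite le_measure// inE.
exists P, jp, jn; split => //.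
- by split; rewrite -ge0_fin_numE// fin_num_measure.
- split; first by rewrite NP jpE// setIC PN0 charge0.
  by rewrite jnE// PN0 charge0 oppe0.
- move=> A mA; have h := jordan_decomp PN mA.
  have e0 : (cscale (-1) (jordan_neg PN) A = - jn A)%E by rewrite cscaleN1.
  move: h; rewrite rhoE => h0; have h : (m1 A - m2 A = jp A - jn A)%E by rewrite h0 -e0.
  have jnf : jn A \is a fin_num by exact: fin_num_measure.
  have jpf : jp A \is a fin_num by exact: fin_num_measure.
  move: h (fin _ _ f1 mA) (fin _ _ f2 mA) jnf jpf.
  move: (m1 A) (m2 A) (jp A) (jn A) => [a| |] [b| |] [c| |] [e| |]//= [h] _ _ _ _.
  by congr (_%:E); lra.
- move=> A mA A1 A2.
  have null (m : {measure set T -> \bar R}) B : m A = 0%E -> measurable B -> m (A `&` B) = 0%E.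
    by move=> mA0 mB; apply: subset_measure0 mA0 => //; exact: measurableI.
  by rewrite jpE// jnE// !rhoE !null// !sube0 oppe0.
Qed.

Lemma eq_Rintegral_null d (T : measurableType d) (R : realType)
    (m : {measure set T -> \bar R}) (N : set T) (f g : T -> R) :
  measurable N -> m N = 0%E -> measurable_fun setT f -> measurable_fun setT g ->
  (forall t, ~ N t -> f t = g t) -> \int[m]_t f t = \int[m]_t g t.
Proof.
move=> mN N0 mf mg fg; congr fine; apply: ae_eq_integral => //; try exact/measurable_EFinP.
exists N; split => // t /= h; apply: contrapT => /fg ftgt.
by apply: h => _; rewrite ftgt.
Qed.

Section quantile.
Context (R : realType) (m : {measure set R -> \bar R}).
Hypothesis mfin : (m setT < +oo)%E.
Hypothesis m01 : m (~` `[0, 1]%classic) = 0%E.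
Notation leb := (@lebesgue_measure R).

Let tail (t : R) := fine (m `]t, +oo[%classic).

Let finm A : measurable A -> m A \is a fin_num.
Proof.
move=> mA; rewrite ge0_fin_numE//; apply: le_lt_trans mfin.
by rewrite le_measure// inE.
Qed.

Let tail_anti s t : s <= t -> tail t <= tail s.
Proof.
move=> st; apply: fine_le; rewrite ?finm//; apply: le_measure; rewrite ?inE// => u.
by rewrite /= !in_itv/= !andbT; exact: le_lt_trans.
Qed.

Let tail1 : tail 1 = 0.
Proof.
rewrite /tail (_ : m _ = 0%E)//; apply: subset_measure0 m01 => //.
  exact: measurableC.
by move=> u /=; rewrite !in_itv/= andbT => u1 /andP[_]; rewrite leNgt u1.
Qed.

Let tail_neg t : t < 0 -> tail t = fine (m setT).
Proof.
move=> t0; congr fine; pose A : set R := `]t, +oo[%classic.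
have mA : measurable A by exact: measurable_itv.
have A0 : m (~` A) = 0%E.
  apply: subset_measure0 m01; try exact: measurableC.
  move=> u /=; rewrite /A /= !in_itv/= andbT => /negP; rewrite -leNgt => ut /andP[u0 _].
  by move: t0; rewrite ltNge (le_trans u0 ut).
by rewrite -(setUv A) measureU0//; exact: measurableC.
Qed.

Let tail_right_continuous a u : u < tail a -> exists2 t, a < t & u < tail t.
Proof.
move=> ua; pose F n : set R := `]a + n.+1%:R^-1, +oo[%classic.
have FE : \bigcup_n F n = `]a, +oo[%classic.
  apply/seteqP; split => t /=.
    move=> [n _]; rewrite /F /= !in_itv/= !andbT; apply: lt_trans.
    by rewrite ltrDl invr_gt0.
  rewrite in_itv/= andbT => at_; have ta : 0 < t - a by rewrite subr_gt0.
  exists (Num.trunc (t - a)^-1) => //; rewrite /F/= in_itv/= andbT -ltrBrDl.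
  by rewrite invf_plt ?posrE// truncnS_gt.
have cvgF : m \o F @ \oo --> m `]a, +oo[%classic.
  rewrite -FE; apply: nondecreasing_cvg_mu.
  - by move=> n; exact: measurable_itv.
  - by rewrite FE; exact: measurable_itv.
  - move=> n k nk; apply/subsetPset => t; rewrite /F/= !in_itv/= !andbT.
    by apply: le_lt_trans; rewrite lerD2l lef_pV2 ?posrE// ler_nat.
apply: contrapT => H.
suff : tail a <= u by rewrite leNgt ua.
rewrite -lee_fin /tail fineK ?finm// -(cvg_lim (@ereal_hausdorff R) cvgF).
apply: lime_le; first by apply/cvg_ex; eexists; exact: cvgF.
apply: nearW => n; have mFn : m (F n) = (tail (a + n.+1%:R^-1))%:E by rewrite /tail fineK// finm.
rewrite /= mFn lee_fin leNgt.
apply/negP => h; apply: H; exists (a + n.+1%:R^-1) => //.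
by rewrite ltrDl invr_gt0.
Qed.

Let level u := [set t : R | 0 <= t <= 1 /\ u < tail t].

(** The generalized inverse of the nonincreasing function t |-> m(]t, +oo[). *)
Definition quantile u := sup (level u).

Let level_ub u : has_ubound (level u).
Proof. by exists 1 => t [/andP[]]. Qed.

Lemma quantile_itv u : 0 <= quantile u <= 1.
Proof.
have [E|/set0P[t tu]] := eqVneq (level u) set0.
  by rewrite /quantile E sup0 lexx ler01.
apply/andP; split.
  by apply: (@le_trans _ _ t); [case: tu => /andP[]|exact: ub_le_sup].
by apply: ge_sup; [exists t|move=> s [/andP[]]].
Qed.

Lemma quantile_anti u v : u <= v -> quantile v <= quantile u.
Proof.
move=> uv; have [E|/set0P v0] := eqVneq (level v) set0.
  by rewrite {1}/quantile E sup0; case/andP: (quantile_itv u).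
apply: ge_sup => // t [t01 vt]; apply: ub_le_sup => //.
by split=> //; exact: le_lt_trans uv vt.
Qed.

Lemma measurable_quantile : measurable_fun setT quantile.
Proof. by apply: nonincreasing_measurable => // u v; exact: quantile_anti. Qed.

(** The Galois connection between the tail function and its inverse; the
    implication from right to left is right continuity of the tail. *)
Lemma quantile_gt a u : 0 <= a -> 0 <= u -> (a < quantile u) = (u < tail a).
Proof.
move=> a0 u0; apply/idP/idP => h.
  have l0 : level u !=set0.
    apply/set0P/eqP => E; move: h; rewrite /quantile E sup0 ltNge a0//.
  have [t [_ ut] at_] := sup_gt l0 h; apply: lt_le_trans ut _.
  exact/tail_anti/ltW.
have [t at_ ut] := tail_right_continuous h.
apply: (lt_le_trans at_); apply: ub_le_sup => //; split => //.
rewrite (le_trans a0 (ltW at_))/= leNgt; apply/negP => t1.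
have := tail_anti (ltW t1); rewrite tail1 => h0.
by move: ut; rewrite ltNge (le_trans h0 u0).
Qed.

Let V := fine (m setT).
Let V0 : 0 <= V. Proof. exact: fine_ge0. Qed.

(** Both measures give a ray ]a, +oo[ the length of the segment where the
    quantile exceeds a. *)
Lemma image_quantile A : measurable A ->
  image_measure (mrestr leb (measurable_itv `[0, V])) measurable_quantile A = m A.
Proof.
apply: eq_measure_rays => [|a].
  by rewrite /= /pushforward /mrestr preimage_setT setTI lebesgue_itv0_lty.
rewrite /image_measure /= /pushforward /mrestr.
have tailE t : (tail t)%:E = m `]t, +oo[%classic by rewrite /tail fineK// finm.
rewrite -tailE.
have [a0|a0] := ltP a 0.
  rewrite (_ : _ `&` _ = `[0, V]%classic); first by rewrite lebesgue_itv0// tail_neg.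
  apply/seteqP; split => u /=; first by case.
  move=> uV; split=> //; rewrite in_itv/= andbT; apply: lt_le_trans a0 _.
  by case/andP: (quantile_itv u).
have tV : tail a <= V by apply: fine_le; rewrite ?finm// le_measure ?inE.
rewrite (_ : _ `&` _ = `[0, tail a[%classic); first by rewrite lebesgue_itv0o// fine_ge0.
apply/seteqP; split => u /=; rewrite !in_itv/= andbT.
  by move=> [+ /andP[u0 uV]]; rewrite quantile_gt// u0.
move=> /andP[u0 ut]; rewrite quantile_gt// u0 ut/=; split => //.
exact/ltW/(lt_le_trans ut).
Qed.

End quantile.

(** * Every transform is a tropical integral *)

Section tropical_form.
Context (R : realType).
Notation leb := (@lebesgue_measure R).

(** The family is the quantile function of m, with the sign prescribed at the
    point that it takes as value: the sign is then constant on the level sets of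
    the absolute value, which is the tropical condition. *)
Lemma tropical_of_signed_density (m : {measure set R -> \bar R}) (P : set R) :
  (m setT < +oo)%E -> m (~` `[0, 1]%classic) = 0%E -> measurable P ->
  exists V x, tropical_family V x /\
    tropical_integral V x =
      fun z => \int[m]_t ((\1_P t - \1_(~` P) t) * teich (clamp t) z).
Proof.
move=> mfin m01 mP.
pose V := fine (m setT); have V0 : 0 <= V by exact: fine_ge0.
pose s t : R := \1_P t - \1_(~` P) t.
have s1 t : s t = 1 \/ s t = -1.
  rewrite /s !indicE in_setC; case: (t \in P) => /=; [left|right].
    by rewrite subr0.
  by rewrite sub0r.
have ms : measurable_fun setT s.
  by apply: measurable_funB; apply: measurable_indic => //; exact: measurableC.
have normr_s t : `|s t| = 1 by case: (s1 t) => ->; rewrite ?normrN normr1.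
pose q := quantile m; have mq := measurable_quantile m.
have q01 u : 0 <= q u <= 1 by exact: quantile_itv.
have normr_q u : `|q u| = q u by rewrite ger0_norm//; case/andP: (q01 u).
pose x u := s (q u) * q u.
have normr_x u : `|x u| = q u by rewrite normrM normr_s mul1r.
have mx : measurable_fun setT x.
  by apply: measurable_funM => //; exact: measurableT_comp ms mq.
have trop : tropical_family V x.
  split => //.
  - exact: measurable_funTS.
  - by move=> u _; rewrite in_itv/= -ler_norml normr_x; case/andP: (q01 u).
  - move=> u v _ _ uv; split; rewrite !normr_x; first exact: quantile_anti.
    by rewrite /x => ->.
exists V, x; split => //; apply/funext => z.
pose h t := s t * teich (clamp t) z.
have mh : measurable_fun setT h.
  by apply: measurable_funM => //; exact: measurable_teich_clamp.
have h1 t : `|h t| <= 1 by rewrite normrM normr_s mul1r; exact: normr_teich_clamp_le1.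
have hq u : teich (x u) z = h (q u).
  rewrite /x /h clamp_id ?normr_q; last by case/andP: (q01 u).
  by rewrite teichM; case: (s1 (q u)) => ->; rewrite ?teichN /teich sgr1 normr1 powR1 !mul1r.
transitivity (\int[mrestr leb (measurable_itv `[0, V])]_u h (q u)).
  rewrite (Rintegral_mrestr _ (M := 1)) ?lebesgue_itv0_lty//.
    by apply: eq_Rintegral => u _; rewrite hq.
  exact: measurableT_comp mh mq.
rewrite -(@Rintegral_image_measure _ _ _ _ _ (mrestr leb (measurable_itv `[0, V]))
  _ (measurable_quantile m) h 1)//; last first.
  by rewrite /= /mrestr setTI lebesgue_itv0_lty.
by congr fine; apply: eq_measure_integral => A mA _; exact: image_quantile.
Qed.

(** Folding the measure at 0 gives two measures on [0, 1], the images of nu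
    under the positive and the negative part of the variable, whose transforms
    differ by that of nu; then their difference is decomposed. *)
Lemma laplace_jordan (nu : {measure set R -> \bar R}) : (nu setT < +oo)%E ->
  exists (m : {measure set R -> \bar R}) (P : set R),
    [/\ (m setT < +oo)%E, m (~` `[0, 1]%classic) = 0%E, measurable P &
      laplace nu =
        fun z => \int[m]_t ((\1_P t - \1_(~` P) t) * teich (clamp t) z)].
Proof.
move=> nufin.
pose a (t : R) : R := Num.max (clamp t) 0; pose b (t : R) : R := Num.max (- clamp t) 0.
have mc := @measurable_clamp R.
have ma : measurable_fun setT a by exact: measurable_maxr.
have mb : measurable_fun setT b by apply: measurable_maxr => //; exact: measurableT_comp.
have c1 (t : R) : -1 <= clamp t <= 1 by rewrite -ler_norml normr_clamp.
have a01 t : 0 <= a t <= 1.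
  by rewrite /a le_max lexx orbT/= ge_max ler01 andbT; case/andP: (c1 t).
have b01 t : 0 <= b t <= 1.
  by rewrite /b le_max lexx orbT/= ge_max ler01 andbT; have := c1 t; lra.
pose n1 := image_measure nu ma; pose n2 := image_measure nu mb.
have n1f : (n1 setT < +oo)%E by [].
have n2f : (n2 setT < +oo)%E by [].
have n1c : n1 (~` `[0, 1]%classic) = 0%E.
  rewrite /n1 /= /pushforward (_ : _ @^-1` _ = set0) ?measure0//.
  by apply/seteqP; split => // t /=; rewrite in_itv/= a01.
have n2c : n2 (~` `[0, 1]%classic) = 0%E.
  rewrite /n2 /= /pushforward (_ : _ @^-1` _ = set0) ?measure0//.
  by apply/seteqP; split => // t /=; rewrite in_itv/= b01.
have [P [jp [jn [mP [jpf jnf] [jpP jnP] jdec jnull]]]] := Jordan_difference n1f n2f.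
have mcpl : measurable (~` `[0, 1]%classic : set R) by exact: measurableC.
have [jp0 jn0] := jnull _ mcpl n1c n2c.
exists (measure_add jp jn), P; split => //.
- by rewrite [X in (X < _)%E](measure_addE jp jn setT) lte_add_pinfty.
- by apply: (etrans (measure_addE jp jn _)); rewrite jp0 jn0 adde0.
apply/funext => z; pose g (t : R) := teich (clamp t) z.
have mg : measurable_fun setT g by exact: measurable_teich_clamp.
have g1 t : `|g t| <= 1 by exact: normr_teich_clamp_le1.
have ig (m : {measure set R -> \bar R}) : (m setT < +oo)%E -> m.-integrable setT (EFin \o g).
  by move=> mfin; apply: (integrable_bounded (M := 1)).
have -> : laplace nu z = \int[n1]_t g t - \int[n2]_t g t.
  rewrite !(Rintegral_image_measure _ (M := 1))//.
  have bd (f : R -> R) : measurable_fun setT f ->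
      nu.-integrable setT (EFin \o (fun t => g (f t))).
    move=> mf; apply: (integrable_bounded (M := 1)) => //.
    exact: measurableT_comp mg mf.
  rewrite -RintegralB//; [|exact: bd|exact: bd].
  apply: eq_Rintegral => t _; rewrite /g (@clamp_id _ (a t)) ?(@clamp_id _ (b t)).
  - rewrite /a /b; have [t0|t0] := leP (clamp t) 0.
      by rewrite max_l ?oppr_ge0// teichN /teich sgr0 mul0r sub0r opprK.
    by rewrite max_r ?oppr_le0 ?ltW// /teich sgr0 mul0r subr0.
  - by rewrite ger0_norm; case/andP: (b01 t).
  - by rewrite ger0_norm; case/andP: (a01 t).
have -> : \int[n1]_t g t - \int[n2]_t g t = \int[jp]_t g t - \int[jn]_t g t.
  have : \int[measure_add n1 jn]_t g t = \int[measure_add n2 jp]_t g t.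
    congr fine; apply: eq_measure_integral => A mA _.
    apply: (etrans (measure_addE n1 jn A)); apply: (etrans (jdec A mA)).
    exact/esym/measure_addE.
  by rewrite !(Rintegral_measure_add (M := 1))//; lra.
pose s t : R := \1_P t - \1_(~` P) t.
have ms : measurable_fun setT s.
  by apply: measurable_funB; apply: measurable_indic => //; exact: measurableC.
have sP t : P t -> s t = 1.
  by move=> Pt; rewrite /s !indicE in_setC mem_set// subr0.
have sN t : ~ P t -> s t = -1.
  by move=> Pt; rewrite /s !indicE in_setC memNset// sub0r.
have msg : measurable_fun setT (fun t => s t * g t) by exact: measurable_funM.
rewrite (Rintegral_measure_add (f := fun t => s t * g t) (M := 1))//; last first.
  move=> t; rewrite normrM mulr_ile1//.
  by have [/sP ->|/sN ->] := pselect (P t); rewrite ?normrN normr1.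
congr (_ + _).
  apply: (eq_Rintegral_null (measurableC mP) jpP) => // t Pt.
  by rewrite sP ?mul1r//; exact: contrapT.
rewrite -mulN1r -RintegralZl//; last exact: ig.
apply: (eq_Rintegral_null mP jnP) => //; first exact: measurable_funM.
by move=> t /sN ->.
Qed.

Lemma has_mass_tropical (f : {posnum R} -> R) M : has_mass f M ->
  exists V x, tropical_family V x /\ f = tropical_integral V x.
Proof.
move=> [nu [nuM ->]]; have nuf : (nu setT < +oo)%E by rewrite nuM ltry.
have [m [P [mf m01 mP ->]]] := laplace_jordan nuf.
by have [V [x [trop E]]] := tropical_of_signed_density mf m01 mP; exists V, x.
Qed.

End tropical_form.

(** * Complete norms on linear subspaces *)

(** Completeness is required for series with a geometric bound on the norms of
    the terms; every Cauchy filter can be refined to such a series. *)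
Record complete_norm_on (R : realType) (V : lmodType R) (B : set V) (N : V -> R) :
    Prop := CompleteNormOn {
  norm_on0 : B 0;
  norm_onD : forall f g, B f -> B g -> B (f + g) /\ N (f + g) <= N f + N g;
  norm_onZ : forall (c : R) f, B f -> B (c *: f) /\ N (c *: f) = `|c| * N f;
  norm_on_eq0 : forall f, B f -> N f = 0 -> f = 0;
  norm_on_series : forall g : nat -> V,
    (forall k, B (g k)) -> (forall k, N (g k) <= 2^-1 ^+ k) ->
    exists2 f, B f & forall n, N (f - \sum_(k < n) g k) <= 2 * 2^-1 ^+ n }.

Section normed_subspace.
Context (R : realType) (V : lmodType R) (B : set V) (N : V -> R).
Context (BN : complete_norm_on B N).

Definition in_subspace : pred V := fun f => f \in B.

(** The type depends on the proof that N is a complete norm, which its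
    normed module structure needs. *)
Definition normed_subspace of complete_norm_on B N := {f : V | in_subspace f}.
Notation E := (normed_subspace BN).

HB.instance Definition _ := SubChoice.on E.

Let inE' f : (f \in in_subspace) = (f \in B). Proof. by []. Qed.

Lemma in_subspace_closed : subsemimod_closed in_subspace.
Proof.
split; first split.
- by rewrite inE' mem_set//; exact: norm_on0 BN.
- by move=> f g; rewrite !inE' !inE => Bf Bg; case: (norm_onD BN Bf Bg).
- by move=> c f; rewrite !inE' !inE => Bf; case: (norm_onZ BN c Bf).
Qed.

HB.instance Definition _ :=
  GRing.SubChoice_isSubLmodule.Build R V in_subspace E in_subspace_closed.

Definition subspace_norm (e : E) : R := N (val e).

Let memE (e : E) : B (val e). Proof. by have := valP e; rewrite /in_subspace inE. Qed.

Let ler_normD (e1 e2 : E) : subspace_norm (e1 + e2) <= subspace_norm e1 + subspace_norm e2.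
Proof.
by rewrite /subspace_norm raddfD; case: (norm_onD BN (memE e1) (memE e2)).
Qed.

Let normrZ (c : R) (e : E) : subspace_norm (c *: e) = `|c| * subspace_norm e.
Proof. by rewrite /subspace_norm linearZ/=; case: (norm_onZ BN c (memE e)). Qed.

Let normr0_eq0 (e : E) : subspace_norm e = 0 -> e = 0.
Proof.
by move=> /(norm_on_eq0 BN (memE e)) e0; apply: val_inj; rewrite e0 raddf0.
Qed.

HB.instance Definition _ := Lmodule_isNormed.Build R E ler_normD normrZ normr0_eq0.

Let norm_valE (e : E) : `|e| = N (val e). Proof. by []. Qed.

(** A Cauchy filter has points a_n with a ball of radius 2^-n / 4 around a_n in
    the filter; the series of the differences a_(n+1) - a_n then satisfies the
    bound required. *)
Lemma normed_subspace_complete (F : set_system E) :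
  ProperFilter F -> cauchy F -> cvg F.
Proof.
move=> FF Fc.
have /choice[a aF] : forall n : nat, exists a : E, F (ball a (2^-1 ^+ n / 4)).
  by move=> n; move/cauchyP : Fc; apply; rewrite divr_gt0// exprn_gt0.
have a_close n : `|a n.+1 - a n| <= 2^-1 ^+ n.
  have [b []] := @filter_ex _ _ FF _ (filterI (aF n.+1) (aF n)).
  rewrite -!ball_normE /= => h1 h2.
  have := ler_distD b (a n.+1) (a n).
  have := exprS (2^-1 : R) n; have : 0 <= (2^-1 : R) ^+ n by exact: exprn_ge0.
  by move: h1 h2; rewrite (distrC (a n) b); lra.
pose g n := val (a n.+1 - a n).
have [f Bf fg] : exists2 f, B f & forall n, N (f - \sum_(k < n) g k) <= 2 * 2^-1 ^+ n.
  by apply: (norm_on_series BN) => k; [exact: memE|exact: a_close].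
have gsum n : \sum_(k < n) g k = val (a n) - val (a 0%N).
  elim: n => [|n IH]; first by rewrite big_ord0 subrr.
  by rewrite big_ord_recr/= IH /g raddfB/= addrC addrA subrK.
pose e : E := Sub f (mem_set Bf) + a 0%N.
have ae n : `|e - a n| <= 2 * 2^-1 ^+ n.
  apply: le_trans (fg n); rewrite norm_valE gsum /e raddfB raddfD/=.
  by rewrite opprB addrA.
apply/cvg_ex; exists e; apply/cvgrPdist_le => eps eps0.
have : (fun n => 3 * (2^-1 : R) ^+ n) @ \oo --> (3 * 0 : R).
  by apply: cvgMr; apply: cvg_expr; rewrite ger0_norm// invf_lt1// ltr1n.
rewrite mulr0 => /cvgrPdist_lt /(_ eps eps0)[n _ /(_ n (leqnn n))] /=.
rewrite sub0r normrN ger0_norm ?mulr_ge0// ?exprn_ge0// => neps.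
apply: filterS (aF n) => b; rewrite -ball_normE/= => h.
have := ler_distD (a n) e b; have := ae n.
have : 0 <= (2^-1 : R) ^+ n by exact: exprn_ge0.
by lra.
Qed.

HB.instance Definition _ := Uniform_isComplete.Build E normed_subspace_complete.

Lemma complete_normed_subspace :
  exists (E : completeNormedModType R) (j : {linear E -> V}),
    [/\ injective j, range j = B & forall e : E, N (j e) = `|e|].
Proof.
exists E, (val : {linear E -> V}); split => //.
apply/seteqP; split => f /=; first by move=> [e _ <-]; exact: memE.
by move=> Bf; exists (Sub f (mem_set Bf)).
Qed.

End normed_subspace.

(** * The norm of the algebra *)

Section tropical_norm.
Context (R : realType).
Implicit Types (f g : {posnum R} -> R).

(** Since transforms are described by positive measures of any mass, this makes
    sense without reference to tropical families, and the independence of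
    [support_sup] of the family becomes a consequence of [tropical_normE]. *)
Definition tropical_norm f : R := inf [set M | has_mass f M].

Lemma tropical_norm_le f M : has_mass f M -> tropical_norm f <= M.
Proof.
move=> fM; apply: ge_inf => //.
by exists 0 => K; exact: has_mass_ge0.
Qed.

Lemma tropical_normE V x : tropical_family V x ->
  tropical_norm (tropical_integral V x) = support_sup V x.
Proof.
move=> trop; have xS := tropical_integral_has_mass trop.
apply/eqP; rewrite eq_le tropical_norm_le//=.
apply: lb_le_inf; first by eexists; exact: xS.
by move=> M; exact: support_sup_le_mass.
Qed.

Lemma Bbp_infty_has_mass f : Bbp_infty R f <-> exists M, has_mass f M.
Proof.
split=> [[V [x [trop ->]]]|[M fM]]; last exact: has_mass_tropical fM.
by exists (support_sup V x); exact: tropical_integral_has_mass.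
Qed.

(** The infimum is attained, by the tropical description. *)
Lemma tropical_norm_has_mass f : Bbp_infty R f -> has_mass f (tropical_norm f).
Proof.
by move=> [V [x [trop ->]]]; rewrite tropical_normE//; exact: tropical_integral_has_mass.
Qed.

Lemma Bbp_infty_mass f M : has_mass f M -> Bbp_infty R f.
Proof. by move=> fM; apply/Bbp_infty_has_mass; exists M. Qed.

Lemma tropical_normM f g : Bbp_infty R f -> Bbp_infty R g ->
  Bbp_infty R (f * g) /\ tropical_norm (f * g) <= tropical_norm f * tropical_norm g.
Proof.
move=> /tropical_norm_has_mass fM /tropical_norm_has_mass gM.
have fgM := has_massM fM gM.
by split; [exact: Bbp_infty_mass fgM|exact: tropical_norm_le].
Qed.

Lemma tropical_norm1 : Bbp_infty R (cst 1) /\ tropical_norm (cst 1) = 1.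
Proof.
have := has_mass_cst (1 : R); rewrite normr1 => m1.
split; first exact: Bbp_infty_mass m1.
apply/eqP; rewrite eq_le tropical_norm_le//=.
apply: lb_le_inf; first by exists 1.
by move=> M /(has_mass_normr_le (PosNum (@ltr01 R))); rewrite normr1.
Qed.

Lemma tropical_norm_complete : complete_norm_on (Bbp_infty R) tropical_norm.
Proof.
have normZ_le (c : R) f : Bbp_infty R f -> has_mass (c *: f) (`|c| * tropical_norm f).
  by move=> /tropical_norm_has_mass; exact: has_massZ.
split.
- have := has_mass_cst (0 : R); exact: Bbp_infty_mass.
- move=> f g /tropical_norm_has_mass fM /tropical_norm_has_mass gM.
  have fgM := has_massD fM gM.
  by split; [exact: Bbp_infty_mass fgM|exact: tropical_norm_le].
- move=> c f Bf; have cfM := normZ_le c f Bf; have Bcf := Bbp_infty_mass cfM.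
  split => //; apply/eqP; rewrite eq_le tropical_norm_le//=.
  have := has_mass_ge0 (tropical_norm_has_mass Bcf).
  have [->|c0 _] := eqVneq c 0; first by rewrite normr0 mul0r.
  have := tropical_norm_le (normZ_le c^-1 _ Bcf).
  by rewrite scalerA mulVf// scale1r normfV mulrC ler_pdivlMr ?normr_gt0// mulrC.
- move=> f /tropical_norm_has_mass + f0; rewrite f0 => fM; apply/funext => z.
  by apply/eqP; rewrite -normr_le0; exact: has_mass_normr_le.
- move=> g Bg g1.
  have [f fg] := has_mass_series (fun k => tropical_norm_has_mass (Bg k)) g1.
  exists f.
    by have [M + _] := fg 0%N; rewrite big_ord0 subr0; exact: Bbp_infty_mass.
  by move=> n; have [M /tropical_norm_le h] := fg n; exact: le_trans.
Qed.

End tropical_norm.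

(* The existence of [norm0] includes that the map in the statement is well
   defined, i.e. that [support_sup V x] depends only on the function. *)
Theorem theorem5p3 (R : realType) :
  exists norm0 : ({posnum R} -> R) -> R,
    (forall (V : R) (x : R -> R), tropical_family V x ->
       norm0 (tropical_integral V x) = support_sup V x) /\
    banach_function_algebra (Bbp_infty R) norm0.
Proof.
exists (@tropical_norm R); split; first exact: tropical_normE.
split; first exact: complete_normed_subspace (tropical_norm_complete R).
- exact: tropical_normM.
- exact: tropical_norm1.
Qed.
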